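(* Let $k\geq 13$ be a positive integer. Let $A$ be a set of $k$ integers such that $\min(A)=0$, $\gcd(A)=1$, and $|3^{\wedge}A| = 3k-5$. Then $A=[0,k+2]\setminus\{x,y,z\}$, where $\{x,y,z\}$ is one of the sets $\{1,2,3\}$, $\{k-1,k,k+1\}$, $\{1,2,k+1\}$, $\{1,k,k+1\}$, $\{1,3,k+2\}$, $\{k-2,k,k+2\}$, $\{1,4,k+2\}$, $\{k-3,k,k+2\}$, $\{2,k,k+2\}$, $\{1,k-1,k+2\}$, $\{1,k-2,k+2\}$, $\{3,k,k+2\}$, or $\{r,k+1,k+2\}$ with $4\leq r\leq k-4$.
   Context: For a finite set $A$ of integers and a positive integer $h\le |A|$, the restricted $h$-fold sumset $h^{\wedge}A$ is the set of all sums of $h$ distinct elements of $A$. For integers $\alpha\le\beta$, $[\alpha,\beta]=\{x\in\mathbb{Z}:\alpha\le x\le\beta\}$. $\gcd(A)$ denotes the greatest common divisor of the elements of $A$. *)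

(* Defs.v *)
From HB Require Import structures.
From mathcomp Require Import all_boot all_order all_algebra finmap.
Set Implicit Arguments.
Unset Strict Implicit.
Unset Printing Implicit Defensive.
Import Order.TTheory GRing.Theory Num.Theory.
Local Open Scope fset_scope.
Local Open Scope ring_scope.

Definition restricted_sumset (h : nat) (A : {fset int}) : {fset int} :=
  [fset \sum_(x <- B) x | B : {fset int} in
      [fset C in fpowerset A | #|` C| == h]].

Lemma restricted_sumsetP (h : nat) (A : {fset int}) (s : int) :
  reflect (exists B : {fset int},
             [/\ B `<=` A, #|` B| = h & s = \sum_(x <- B) x])
          (s \in restricted_sumset h A).
Proof.
apply: (iffP (imfsetP _ _ _ _)) => [[B] /=|[B [BA hB ->]]].
  by rewrite !inE fpowersetE => /andP[BA /eqP hB] ->; exists B.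
by exists B => //=; rewrite !inE fpowersetE BA hB eqxx.
Qed.

Definition is_min (A : {fset int}) (m : int) : Prop :=
  m \in A /\ forall x : int, x \in A -> m <= x.

Definition gcd_fset (A : {fset int}) : int := \big[gcdz/0]_(x <- A) x.

(* When a <= b, the natural absolute value below is b - a + 1; the case
   a > b is empty thanks to the filter. *)
Definition int_interval (a b : int) : {fset int} :=
  [fset x in [seq a + i%:Z | i <- iota 0 (absz (b - a + 1))] | x <= b].

Lemma in_int_interval (a b x : int) :
  (x \in int_interval a b) = (a <= x <= b).
Proof.
rewrite !inE; apply/andP/andP => -[].
  by case/mapP=> i _ -> le_b; rewrite lerDl.
move=> ax xb; split=> //; apply/mapP; exists (absz (x - a)); last first.
  by rewrite gez0_abs ?subr_ge0 // [RHS]addrC subrK.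
have ab := le_trans ax xb.
rewrite mem_iota add0n leq0n /= -ltz_nat !gez0_abs ?subr_ge0 //.
  by rewrite ltzD1 lerD2r.
by rewrite addr_ge0 // subr_ge0.
Qed.

(* Main.v *)
Require Import Defs.
From HB Require Import structures.
From mathcomp Require Import all_boot all_order all_algebra finmap zify.
Set Implicit Arguments.
Unset Strict Implicit.
Unset Printing Implicit Defensive.
Import Order.TTheory GRing.Theory Num.Theory.

(* Encode A by the list g of gaps between consecutive elements and call
   |3^A| - (3|A| - 8) the excess; here it is 3.  If two blocks of consecutive elements
   overlap in three elements, or in a run of consecutive integers, the excess of their
   union is at least the sum of their excesses.  A set of 13 elements contains five
   5-element blocks that overlap successively in three elements, so one of them has excess
   0, which forces it to be an arithmetic progression.  An element outside the residue
   class of this progression would create too many new sums, so the common difference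
   divides all gaps and is 1.  Growing the resulting run of five consecutive integers one
   gap at a time, with excess at most 3, leaves finitely many possibilities for the first
   13 elements; adding further elements on the right then only lengthens the long run of
   gaps 1, because the excesses at both ends of that run add up. *)

(** * Sums of two and of three distinct elements of a sorted list *)

Fixpoint pair_sums (s : seq nat) : seq nat :=
  if s is x :: s' then [seq x + y | y <- s'] ++ pair_sums s' else [::].

Fixpoint triple_sums (s : seq nat) : seq nat :=
  if s is x :: s' then [seq x + p | p <- pair_sums s'] ++ triple_sums s'
  else [::].

Lemma pair_sumsP (s : seq nat) (v : nat) : sorted ltn s ->
  reflect (exists x y, [/\ x \in s, y \in s, x < y & v = x + y])
          (v \in pair_sums s).
Proof.
elim: s v => [|a s IHs] v /=; first by move=> _; constructor=> -[x [y []]].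
rewrite (path_sortedE ltn_trans) => /andP[/allP a_min s_sorted].
have {}IHs u := IHs u s_sorted.
rewrite mem_cat; apply: (iffP orP) => [[/mapP[y ys ->]|/IHs]|].
- by exists a, y; rewrite !inE eqxx ys orbT; split=> //; apply: a_min.
- by case=> x [y [xs ys xy ->]]; exists x, y; rewrite !inE xs ys !orbT.
case=> x [y []]; rewrite !inE => /predU1P[->|xs] /predU1P[->|ys] xy ->.
- by rewrite ltnn in xy.
- by left; apply: map_f.
- by have := a_min _ xs; rewrite /= ltnNge (ltnW xy).
by right; apply/IHs; exists x, y.
Qed.

Lemma triple_sumsP (s : seq nat) (v : nat) : sorted ltn s ->
  reflect (exists x y z, [/\ x \in s, y \in s & z \in s] /\
             [/\ x < y, y < z & v = x + y + z])
          (v \in triple_sums s).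
Proof.
elim: s v => [|a s IHs] v /=; first by move=> _; constructor=> -[x [y [z [[]]]]].
rewrite (path_sortedE ltn_trans) => /andP[/allP a_min s_sorted].
have {}IHs u := IHs u s_sorted.
rewrite mem_cat; apply: (iffP orP) => [[/mapP[p ps ->]|/IHs]|].
- have [y [z [ys zs yz ->]]] := pair_sumsP _ s_sorted ps.
  exists a, y, z; rewrite !inE eqxx ys zs !orbT addnA; split=> //; split=> //.
  exact: a_min.
- by case=> x [y [z [[xs ys zs] ?]]]; exists x, y, z; rewrite !inE xs ys zs !orbT.
case=> x [y [z [[]]]]; rewrite !inE => xs ys zs [xy yz ->].
have gt_a u t : (t == a) || (t \in s) -> u < t -> (u == a) || (u \in s) -> t \in s.
  case/predU1P=> // -> ua /predU1P[ue|/a_min /= ]; first by rewrite ue ltnn in ua.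
  by move=> au; have := ltn_trans au ua; rewrite ltnn.
have {}ys := gt_a _ _ ys xy xs.
have {}zs : z \in s by apply: (gt_a y) => //; rewrite ys orbT.
case/predU1P: xs => [->|xs]; last by right; apply/IHs; exists x, y, z.
by left; rewrite -addnA map_f //; apply/pair_sumsP => //; exists y, z.
Qed.

(** * Finite sets with minimum 0 encoded by gap lists *)

Fixpoint pts (g : seq nat) : seq nat :=
  if g is d :: g' then 0 :: [seq d + x | x <- pts g'] else [:: 0].

Lemma size_pts g : size (pts g) = (size g).+1.
Proof. by elim: g => //= d g IHg; rewrite size_map IHg. Qed.

Lemma mem0_pts g : 0 \in pts g.
Proof. by case: g => *; rewrite inE. Qed.

Lemma mem_map_addn d x s : (x \in [seq d + y | y <- s]) = (d <= x) && (x - d \in s).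
Proof.
apply/mapP/andP => [[y ys ->]|[dx xs]]; first by rewrite leq_addr addKn.
by exists (x - d) => //; rewrite subnKC.
Qed.

Lemma mem_pts_cons d g x :
  (x \in pts (d :: g)) = (x == 0) || (d <= x) && (x - d \in pts g).
Proof. by rewrite inE mem_map_addn. Qed.

Lemma mem_pts_cat p q x :
  (x \in pts (p ++ q)) = (x \in pts p) || (sumn p <= x) && (x - sumn p \in pts q).
Proof.
elim: p x => [|d p IHp] x /=.
  by rewrite inE subn0; case: eqP => [->|] //=; rewrite mem0_pts.
rewrite !mem_pts_cons IHp -orbA; congr (_ || _).
rewrite andb_orr subnDA; congr (_ || _).
by rewrite andbA; congr (_ && _); lia.
Qed.

Lemma mem_pts_nseq1 t x : (x \in pts (nseq t 1)) = (x <= t).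
Proof.
elim: t x => [|t IHt] x; first by rewrite inE; lia.
by rewrite mem_pts_cons IHt; lia.
Qed.

Lemma mem_pts_le g x : x \in pts g -> x <= sumn g.
Proof.
elim: g x => [|d g IHg] x; first by rewrite inE => /eqP->.
by rewrite mem_pts_cons => /predU1P[->|/andP[dx /IHg]] //=; lia.
Qed.

Definition positive (g : seq nat) := all (ltn 0) g.

Lemma sorted_pts g : positive g -> sorted ltn (pts g).
Proof.
elim: g => //= d g IHg /andP[d_gt0 /IHg g_sorted].
rewrite (path_sortedE ltn_trans) sorted_map; apply/andP; split.
  by apply/allP => x; rewrite mem_map_addn /= => /andP[dx _]; lia.
by rewrite (eq_sorted (e' := ltn)) // => x y; rewrite /= ltn_add2l.
Qed.

#[local] Arguments pts : simpl never.

Definition tsums (g : seq nat) := triple_sums (pts g).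

Definition nsums (g : seq nat) := size (undup (tsums g)).

Lemma tsumsP g v : positive g ->
  reflect (exists x y z, [/\ x \in pts g, y \in pts g & z \in pts g] /\
             [/\ x < y, y < z & v = x + y + z])
          (v \in tsums g).
Proof. by move=> g_pos; apply/triple_sumsP/sorted_pts. Qed.

Lemma leq_nsums g s : uniq s -> {subset s <= tsums g} -> size s <= nsums g.
Proof. by move=> s_uniq sg; apply: uniq_leq_size => // x /sg; rewrite mem_undup. Qed.

Lemma geq_nsums g s : {subset tsums g <= s} -> nsums g <= size s.
Proof.
by move=> gs; apply: uniq_leq_size (undup_uniq _) _ => x; rewrite mem_undup => /gs.
Qed.

Lemma positive_cat p q : positive (p ++ q) = positive p && positive q.
Proof. exact: all_cat. Qed.

Lemma positive_rev g : positive (rev g) = positive g.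
Proof. exact: all_rev. Qed.

Lemma mem_pts_rev g x : x \in pts (rev g) -> sumn g - x \in pts g.
Proof.
elim: g x => [|d g IHg] x; first by rewrite !inE.
rewrite rev_cons -cats1 mem_pts_cat sumn_rev => /orP[xg|].
  rewrite mem_pts_cons; have := mem_pts_le xg; rewrite sumn_rev => le_x.
  apply/orP; right; apply/andP; split; first by rewrite /=; lia.
  have -> : sumn (d :: g) - x - d = sumn g - x by rewrite /=; lia.
  exact: IHg.
case/andP=> le_x; have -> : sumn (d :: g) - x = d - (x - sumn g) by rewrite /=; lia.
rewrite !mem_pts_cons !inE => /predU1P[->|?].
  by rewrite subn0 leqnn subnn mem0_pts orbT.
by apply/orP; left; lia.
Qed.

(** Reversing the gaps is the reflection [x] to [sumn g - x], which sends a sum [v] to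
    [3 * sumn g - v]. *)
Lemma nsums_rev_le g : positive g -> nsums (rev g) <= nsums g.
Proof.
move=> g_pos; have rg_pos : positive (rev g) by rewrite positive_rev.
pose f v := 3 * sumn g - v.
have le3 v : v \in undup (tsums (rev g)) -> v <= 3 * sumn g.
  rewrite mem_undup => /(tsumsP _ rg_pos)[x [y [z [[xg yg zg] [_ _ ->]]]]].
  by move: (mem_pts_le xg) (mem_pts_le yg) (mem_pts_le zg); rewrite sumn_rev; lia.
rewrite {1}/nsums -(size_map f); apply: leq_nsums.
  rewrite map_inj_in_uniq ?undup_uniq // => u v /le3 + /le3; rewrite /f; lia.
move=> _ /mapP[v /[dup] /le3 v_le + ->]; rewrite mem_undup.
case/(tsumsP _ rg_pos)=> x [y [z [[xg yg zg] [xy yz def_v]]]].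
apply/tsumsP => //; exists (sumn g - z), (sumn g - y), (sumn g - x).
rewrite !mem_pts_rev //; split=> //.
move: (mem_pts_le xg) (mem_pts_le yg) (mem_pts_le zg); rewrite sumn_rev /f; split; lia.
Qed.

Lemma nsums_rev g : positive g -> nsums (rev g) = nsums g.
Proof.
move=> g_pos; apply/eqP; rewrite eqn_leq nsums_rev_le //=.
by rewrite -{1}[g]revK nsums_rev_le ?positive_rev.
Qed.

(** * Superadditivity of the excess *)

(** The sums of both blocks, the right ones shifted, occur in the union; a value common to both lies
    between [3 * sumn p + lo] and [3 * sumn p + hi]. *)
Lemma nsums_overlap p w q lo hi : positive (p ++ w ++ q) ->
    (forall v, v \in tsums (p ++ w) -> v <= 3 * sumn p + hi) ->
    (forall v, v \in tsums (w ++ q) -> lo <= v) ->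
  nsums (p ++ w) + nsums (w ++ q) <= nsums (p ++ w ++ q) + (hi.+1 - lo).
Proof.
move=> pos hiP loP; move: (pos); rewrite !positive_cat => /and3P[p_pos w_pos q_pos].
have pw_pos : positive (p ++ w) by rewrite positive_cat p_pos.
have wq_pos : positive (w ++ q) by rewrite positive_cat w_pos.
pose U := undup (tsums (p ++ w)).
pose V := [seq 3 * sumn p + v | v <- undup (tsums (w ++ q))].
have V_uniq : uniq V by rewrite map_inj_uniq ?undup_uniq //; apply: addnI.
have szV : size V = nsums (w ++ q) by rewrite size_map.
have : size [seq v <- V | v \in U] <= hi.+1 - lo.
  rewrite -[X in _ <= X](size_iota (3 * sumn p + lo)).
  apply: uniq_leq_size => [|v]; first exact: filter_uniq.
  rewrite mem_filter mem_undup mem_iota => /andP[/hiP ? /mapP[u]].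
  by rewrite mem_undup => /loP ? def_v; lia.
have : size (U ++ [seq v <- V | v \notin U]) <= nsums (p ++ w ++ q).
  apply: leq_nsums => [|v].
    rewrite cat_uniq undup_uniq filter_uniq // andbT /=.
    by apply/hasPn => v; rewrite mem_filter => /andP[].
  rewrite mem_cat mem_undup mem_filter => /orP[/(tsumsP _ pw_pos)|/andP[_ /mapP[u]]].
    move=> [x [y [z [[xg yg zg] ?]]]]; apply/tsumsP => //; exists x, y, z; split=> //.
    by rewrite catA !(mem_pts_cat (p ++ w)) xg yg zg.
  rewrite mem_undup => /(tsumsP _ wq_pos)[x [y [z [[xg yg zg] [? ? ->]]]]] ->.
  apply/tsumsP => //; exists (sumn p + x), (sumn p + y), (sumn p + z).
  by rewrite !mem_pts_cat !leq_addr !addKn -!mem_pts_cat xg yg zg !orbT; split=> //; split; lia.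
have : count (fun v => v \in U) V + count (fun v => v \notin U) V = size V.
  exact: count_predC.
rewrite size_cat !size_filter -szV /nsums -/U; lia.
Qed.

(** The blocks share three elements, whose sum is the largest on the left and the smallest on the
    right, so only this value is counted twice. *)
Lemma nsums_overlap2 p a b q : positive (p ++ [:: a; b] ++ q) ->
  nsums (p ++ [:: a; b]) + nsums ([:: a; b] ++ q) <= (nsums (p ++ [:: a; b] ++ q)).+1.
Proof.
move=> pos; move: (pos); rewrite !positive_cat /= andbT.
case/and3P=> p_pos /andP[a_gt0 b_gt0] q_pos.
rewrite -addn1 -[X in _ <= _ + X](_ : (2 * a + b).+1 - (2 * a + b) = 1); last by lia.
apply: nsums_overlap => // v.
  case/tsumsP; first by rewrite positive_cat p_pos /= a_gt0 b_gt0.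
  move=> x [y [z [[]]]]; rewrite !mem_pts_cat !mem_pts_cons !inE.
  have le u : (u \in pts p) || (sumn p <= u) && ((u - sumn p == 0) ||
       (a <= u - sumn p) && ((u - sumn p - a == 0) ||
       (b <= u - sumn p - a) && (u - sumn p - a - b == 0))) ->
     [|| u <= sumn p, u == sumn p + a | u == sumn p + a + b].
    by case/orP=> [/mem_pts_le|]; lia.
  by move=> /le xP /le yP /le zP [? ? ->]; lia.
case/tsumsP; first by rewrite /= a_gt0 b_gt0.
move=> x [y [z [[]]]]; rewrite cat_cons cat1s !mem_pts_cons => xP yP zP [? ? ->].
by lia.
Qed.

(** The common values lie among the triple sums of the shared [t + 1] consecutive integers, and
    there are [3 * t - 5] of these. *)
Lemma nsums_overlap_run p t q : positive (p ++ nseq t 1 ++ q) -> 2 <= t ->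
  nsums (p ++ nseq t 1) + nsums (nseq t 1 ++ q) <= nsums (p ++ nseq t 1 ++ q) + (3 * t - 5).
Proof.
move=> pos t_ge2; move: (pos); rewrite !positive_cat => /and3P[p_pos t_pos q_pos].
rewrite [X in _ <= _ + X](_ : _ = (3 * t - 3).+1 - 3); last by lia.
apply: nsums_overlap => // v.
  case/tsumsP; first by rewrite positive_cat p_pos.
  move=> x [y [z [[_ _]]]] /mem_pts_le; rewrite sumn_cat sumn_nseq => ? [? ? ->].
  lia.
case/tsumsP; first by rewrite positive_cat t_pos.
by move=> x [y [z [_ [? ? ->]]]]; lia.
Qed.

(** The excess is never negative: four elements have at least four sums, and each further element
    adds at least three. *)
Lemma nsums_ge g : positive g -> 2 <= size g -> 3 * size g <= nsums g + 5.
Proof.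
elim: g => // d [//|a [_|b q IHq]] pos _; move: (pos) => /= /and3P[d_gt0 a_gt0 pos'].
  suff : 0 < nsums [:: d; a] by move=> /=; lia.
  by apply: (@leq_nsums _ [:: 0 + (d + (d + a))]) => // v; rewrite /tsums /pts /= !inE; lia.
have := @nsums_overlap2 [:: d] a b q pos.
have : 4 <= nsums [:: d; a; b].
  move/andP: pos' => [b_gt0 _].
  apply: (@leq_nsums _ [:: 0 + (d + (d + a)); 0 + (d + (d + (a + b)));
    0 + (d + a + (d + (a + b))); d + (d + a + (d + (a + b)))]) => [|v];
    rewrite /tsums /pts /= !inE; lia.
have : 3 * size [:: a, b & q] <= nsums [:: a, b & q] + 5.
  by apply: IHq => //=; rewrite a_gt0.
by rewrite /=; lia.
Qed.

Lemma nsums_cat_ge w q : positive (w ++ q) -> 2 <= size w ->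
  nsums w + 3 * size q <= nsums (w ++ q).
Proof.
elim/last_ind: w => // w b _; elim/last_ind: w => [|w a _]; first by rewrite size_rcons.
rewrite -!cats1 -!catA !cat1s => pos _; have := nsums_overlap2 pos.
have abq_pos : positive ([:: a; b] ++ q) by move: pos; rewrite positive_cat => /andP[].
by have := nsums_ge abq_pos isT; rewrite /=; lia.
Qed.

(** A block has at most the excess of the whole set; elements on its left are handled by
    reflection. *)
Lemma nsums_window p w q : positive (p ++ w ++ q) -> 2 <= size w ->
  nsums w + 3 * (size p + size q) <= nsums (p ++ w ++ q).
Proof.
move=> pos w_ge2; move: (pos); rewrite !positive_cat => /and3P[p_pos w_pos q_pos].
have wq_pos : positive (w ++ q) by rewrite positive_cat w_pos.
have wq := nsums_cat_ge wq_pos w_ge2.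
have := @nsums_cat_ge (rev (w ++ q)) (rev p); rewrite -rev_cat !nsums_rev //.
rewrite positive_rev !size_rev size_cat.
by move=> /(_ pos (leq_trans w_ge2 (leq_addr _ _))); lia.
Qed.

(** * An arithmetic progression of five consecutive elements *)

(** Seven of the ten triple sums form an increasing chain. If there are no other values, the
    remaining three sums lie in the chain, which forces equal gaps. *)
Lemma nsums4_ge8 a b c d : positive [:: a; b; c; d] -> [:: a; b; c; d] != nseq 4 a ->
  8 <= nsums [:: a; b; c; d].
Proof.
move=> /= /and5P[a_gt0 b_gt0 c_gt0 d_gt0 _]; apply: contraNleq => le7.
pose x1 := a; pose x2 := a + b; pose x3 := a + b + c; pose x4 := a + b + c + d.
pose chain := [:: x1 + x2; x1 + x3; x2 + x3; x1 + x2 + x3; x1 + x2 + x4;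
  x1 + x3 + x4; x2 + x3 + x4].
have chain_uniq : uniq chain by rewrite /= !inE /x1 /x2 /x3 /x4; lia.
have [|//|_ chainE] := uniq_min_size (s2 := undup (tsums [:: a; b; c; d])) chain_uniq.
  by move=> v; rewrite mem_undup /tsums /pts /= !inE /x1 /x2 /x3 /x4; lia.
have in_chain v : v \in [:: x1 + x4; x2 + x4; x3 + x4] -> v \in chain.
  rewrite chainE mem_undup /tsums /pts /= !inE /x1 /x2 /x3 /x4; lia.
have : all [in chain] [:: x1 + x4; x2 + x4; x3 + x4] by apply/allP => v /in_chain.
rewrite /chain /= !inE !eqseq_cons !eqxx /= /x1 /x2 /x3 /x4; lia.
Qed.

(** If none of the five windows of four gaps were constant, removing two gaps at a time would lose
    at least 7 sums each, so there would be at least [5 * 7 + 1] sums instead of at most 34. *)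
Lemma exists_run g : positive g -> size g = 12 -> nsums g + 2 <= 3 * size g ->
  exists p D q, g = p ++ nseq 4 D ++ q.
Proof.
case: g => [|x1 [|x2 [|x3 [|x4 [|x5 [|x6 [|x7 [|x8 [|x9 [|x10 [|x11 [|x12 [|? ?]]]]]]]]]]]]] //.
move=> pos _ le_g.
have split a b c d q : positive [:: a, b, c, d & q] -> [:: a; b; c; d] != nseq 4 a ->
    nsums [:: c, d & q] + 7 <= nsums [:: a, b, c, d & q].
  move=> pos' neq; have := @nsums_overlap2 [:: a; b] c d q pos'.
  have abcd_pos : positive [:: a; b; c; d].
    by move: pos'; rewrite -[_ :: _]/([:: a; b; c; d] ++ q) positive_cat => /andP[].
  by have := nsums4_ge8 abcd_pos neq; rewrite /=; lia.
have [[-> -> ->]|neq1] := [:: x1; x2; x3; x4] =P nseq 4 x1.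
  by exists [::], x1, [:: x5; x6; x7; x8; x9; x10; x11; x12].
have [[-> -> ->]|neq3] := [:: x3; x4; x5; x6] =P nseq 4 x3.
  by exists [:: x1; x2], x3, [:: x7; x8; x9; x10; x11; x12].
have [[-> -> ->]|neq5] := [:: x5; x6; x7; x8] =P nseq 4 x5.
  by exists [:: x1; x2; x3; x4], x5, [:: x9; x10; x11; x12].
have [[-> -> ->]|neq7] := [:: x7; x8; x9; x10] =P nseq 4 x7.
  by exists [:: x1; x2; x3; x4; x5; x6], x7, [:: x11; x12].
have [[-> -> ->]|neq9] := [:: x9; x10; x11; x12] =P nseq 4 x9.
  by exists [:: x1; x2; x3; x4; x5; x6; x7; x8], x9, [::].
have posd n : positive (drop n [:: x1; x2; x3; x4; x5; x6; x7; x8; x9; x10; x11; x12]).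
  by apply/allP => x /mem_drop; apply: (allP pos).
have := split _ _ _ _ _ (posd 0) (introN eqP neq1).
have := split _ _ _ _ _ (posd 2) (introN eqP neq3).
have := split _ _ _ _ _ (posd 4) (introN eqP neq5).
have := split _ _ _ _ _ (posd 6) (introN eqP neq7).
have := split _ _ _ _ _ (posd 8) (introN eqP neq9).
have := nsums_ge (posd 10) isT; move: le_g => /=; lia.
Qed.

(** * Sums created by a new largest element, and divisibility of the gaps *)

(** Each pair sum in [s] makes, with the new largest element [sumn g + y], a sum that was not there
    before. *)
Lemma nsums_rcons g y s : positive (rcons g y) -> uniq s ->
    {in s, forall p, p \in pair_sums (pts g) /\ sumn g + y + p \notin tsums g} ->
  nsums g + size s <= nsums (rcons g y).
Proof.
move=> pos s_uniq sP; move: (pos); rewrite -cats1 positive_cat /= andbT => /andP[g_pos y_gt0].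
have -> : nsums g + size s = size (undup (tsums g) ++ [seq sumn g + y + p | p <- s]).
  by rewrite size_cat size_map.
have inl x : x \in pts g -> x \in pts (g ++ [:: y]) by rewrite mem_pts_cat => ->.
have gy_pos : positive (g ++ [:: y]) by rewrite cats1.
apply: leq_nsums.
  rewrite cat_uniq undup_uniq map_inj_uniq ?s_uniq ?andbT //; last exact: addnI.
  by apply/hasPn => _ /mapP[p /sP[_ +] ->]; rewrite /= mem_undup.
move=> v; rewrite mem_cat mem_undup => /orP[/(tsumsP _ g_pos)|/mapP[p /sP[+ _] ->]].
  case=> [x [y' [z [[xg yg zg] ?]]]]; apply/tsumsP => //; exists x, y', z.
  by rewrite !inl.
case/(pair_sumsP _ (sorted_pts g_pos))=> x [y' [xg yg xy ->]].
apply/tsumsP => //; exists x, y', (sumn g + y); split.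
  split; [exact: inl | exact: inl |].
  rewrite mem_pts_cat leq_addr addKn; apply/orP; right.
  by rewrite mem_pts_cons subnn mem0_pts leqnn orbT.
by move: (mem_pts_le yg) => ?; split; lia.
Qed.

Lemma dvd_pts D g x : all (dvdn D) g -> x \in pts g -> D %| x.
Proof.
elim: g x => [|d g IHg] x /=; first by rewrite inE => _ /eqP->.
case/andP=> Dd /IHg{}IHg; rewrite mem_pts_cons => /predU1P[->|/andP[dx /IHg Dxd]] //.
by rewrite -(subnKC dx) dvdn_addr.
Qed.

Lemma mem_pts_sumn g : sumn g \in pts g.
Proof. by elim: g => // d g IHg; rewrite mem_pts_cons /= leq_addr addKn IHg orbT. Qed.

(** At the first gap [y] that [D] does not divide, the new largest element and two elements of the
    run make seven sums that are not multiples of [D]. All old sums are multiples, so seven new sums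
    appear, too many for the allowed excess. *)
Lemma dvd_right_of_run D q : positive (nseq 4 D ++ q) ->
  nsums (nseq 4 D ++ q) + 2 <= 3 * (4 + size q) -> all (dvdn D) q.
Proof.
elim/last_ind: q => // q y; rewrite size_rcons -rcons_cat.
set r := nseq 4 D ++ q => IHq pos le_ry.
have /andP[_ r_pos] : (0 < y) && positive r by move: pos; rewrite /positive all_rcons.
have szr : size r = 4 + size q by rewrite size_cat.
have le_r : nsums r + 3 <= nsums (rcons r y).
  by rewrite -cats1; apply: nsums_cat_ge; rewrite ?cats1 ?szr.
have {}IHq : all (dvdn D) q by apply: IHq => //; lia.
rewrite all_rcons IHq andbT; apply: contraLR le_ry => nDy; rewrite -ltnNge.
have D_all : all (dvdn D) r by rewrite all_cat IHq /= !dvdnn.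
have D_gt0 : 0 < D by case/andP: r_pos.
pose s := [seq D * i | i <- iota 1 7].
have : nsums r + size s <= nsums (rcons r y).
  apply: nsums_rcons => //.
    by rewrite map_inj_uniq ?iota_uniq // => i j /eqP; rewrite eqn_pmul2l // => /eqP.
  move=> _ /mapP[i i_bd ->]; split; last first.
    apply/negP => /(tsumsP _ r_pos)[a [b [c [[/(dvd_pts D_all) Da /(dvd_pts D_all) Db]]]]].
    move=> /(dvd_pts D_all) Dc [_ _ eq_abc].
    have : D %| a + b + c by rewrite !dvdn_add.
    rewrite -eq_abc dvdn_addl ?dvdn_mulr // dvdn_addr; first exact/negP.
    exact: dvd_pts D_all (mem_pts_sumn r).
  apply/pair_sumsP; first exact: sorted_pts.
  have in_run j : j \in iota 0 5 -> D * j \in pts r.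
    rewrite mem_pts_cat => j_bd; apply/orP; left; move: j_bd.
    rewrite -[nseq 4 D]/[:: D; D; D; D] !mem_pts_cons !inE.
    by case/or4P=> [| | |/orP[]] /eqP->; lia.
  (* For [i] from 1 to 7, [i] is the sum of [i - 4] and [minn i 4], distinct numbers up to 4; the
     truncated [i - 4] is 0 for [i <= 4]. *)
  exists (D * (i - 4)), (D * minn i 4); move: i_bd.
  rewrite mem_iota => i_bd; rewrite !in_run ?mem_iota; try lia.
  by rewrite -mulnDr ltn_pmul2l //; split=> //; [lia | congr (D * _); lia].
have := nsums_ge r_pos; rewrite szr => /(_ isT).
by rewrite size_map size_iota; lia.
Qed.

(* Excess at most 3: the set has (size g).+1 elements. *)
Definition small (g : seq nat) := nsums g + 2 <= 3 * size g.

Lemma small_window p w q : positive (p ++ w ++ q) -> 2 <= size w ->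
  small (p ++ w ++ q) -> small w.
Proof.
by move=> pos w_ge2; have := nsums_window pos w_ge2; rewrite /small !size_cat; lia.
Qed.

(** * Computing the number of sums with Boolean masks *)

Fixpoint mask_or (a b : seq bool) : seq bool :=
  match a, b with
  | x :: a', y :: b' => (x || y) :: mask_or a' b'
  | [::], _ => b
  | _, [::] => a
  end.

Definition mask_shift n (a : seq bool) := nseq n false ++ a.

(** Bit [i] of the three masks tells whether [i] is an element, a pair sum or a triple sum. Counting
    distinct sums is then cheap in the later checks by [vm_compute]. *)
Fixpoint sum_masks (s : seq nat) : seq bool * seq bool * seq bool :=
  if s is x :: s' then
    let: (m1, m2, m3) := sum_masks s' in
    (mask_or m1 (mask_shift x [:: true]), mask_or m2 (mask_shift x m1),
     mask_or m3 (mask_shift x m2))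
  else ([::], [::], [::]).

Lemma nth_mask_or a b i : nth false (mask_or a b) i = nth false a i || nth false b i.
Proof.
by elim: a b i => [|x a IHa] [|y b] [|i] //=; rewrite ?orbF ?nth_nil.
Qed.

Lemma nth_mask_shift n a i : nth false (mask_shift n a) i = (n <= i) && nth false a (i - n).
Proof. by rewrite nth_cat size_nseq nth_nseq; case: ltnP. Qed.

Lemma sum_masksP s (m := sum_masks s) v :
  [/\ nth false m.1.1 v = (v \in s), nth false m.1.2 v = (v \in pair_sums s)
    & nth false m.2 v = (v \in triple_sums s)].
Proof.
rewrite {}/m; elim: s v => [|x s IHs] v /=; first by rewrite nth_nil.
case: (sum_masks s) IHs => [[m1 m2] m3] /= IHs.
rewrite !nth_mask_or !nth_mask_shift !mem_cat !mem_map_addn inE.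
have [-> -> ->] := IHs v; have [-> -> _] := IHs (v - x); split; rewrite 1?orbC //.
by congr (_ || _); case: (ltngtP x v) => [xv|//|->]; rewrite ?subnn // nth_default //= subn_gt0.
Qed.

Definition mask_support (m : seq bool) := [seq i <- iota 0 (size m) | nth false m i].

Lemma size_mask_support m : size (mask_support m) = count id m.
Proof.
rewrite size_filter -[in RHS](mkseq_nth false m) /mkseq count_map.
exact: eq_count.
Qed.

Lemma mem_mask_support m i : (i \in mask_support m) = nth false m i.
Proof.
rewrite mem_filter mem_iota /= add0n; case: ltnP => [|le_m]; first by rewrite andbT.
by rewrite nth_default.
Qed.

Definition nsums_mask (g : seq nat) := count id (sum_masks (pts g)).2.

Lemma nsumsE g : nsums g = nsums_mask g.
Proof.
rewrite /nsums_mask -size_mask_support; apply: perm_size; apply: uniq_perm.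
- exact: undup_uniq.
- exact: filter_uniq (iota_uniq _ _).
by move=> v; rewrite mem_undup mem_mask_support; have [_ _ ->] := sum_masksP (pts g) v.
Qed.

(** * Exhaustive extension of a gap list *)

(* Adding a gap y >= 5 after g creates the sums of the new largest point with each pair
   sum p such that p + sumn g + 5 exceeds all old triple sums; those are counted here. *)
Definition next_gap_le4 (g : seq nat) :=
  let: (_, m2, m3) := sum_masks (pts g) in
  3 * size g + 1 < count id m3 + count id (drop (size m3 - (sumn g + 5)) m2).

Lemma next_gap_le4P g y : next_gap_le4 g -> positive (rcons g y) -> small (rcons g y) ->
  y \in [:: 1; 2; 3; 4].
Proof.
rewrite /small size_rcons => le4 pos small_gy.
have y_gt0 : 0 < y by move: pos; rewrite /positive all_rcons => /andP[].
suff : y <= 4 by rewrite !inE; lia.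
rewrite leqNgt; apply/negP => y_ge5.
move: le4 (nsumsE g) (sum_masksP (pts g)); rewrite /next_gap_le4 /nsums_mask.
case: (sum_masks (pts g)) => [[m1 m2] m3] /= le4 nsums_g masksP.
(* When [y >= 5], every pair sum from [k] on yields a value past the end of [m3], hence a new
   sum. *)
set k := size m3 - (sumn g + 5) in le4.
pose s := [seq k + i | i <- mask_support (drop k m2)].
have : nsums g + size s <= nsums (rcons g y).
  apply: nsums_rcons => //.
    by rewrite map_inj_uniq; [rewrite filter_uniq ?iota_uniq | apply: addnI].
  move=> _ /mapP[i + ->]; rewrite mem_mask_support nth_drop => m2i; split.
    by have [_ <- _] := masksP (k + i).
  apply: contraTN isT => sum3; have [_ _] := masksP (sumn g + y + (k + i)).
  by rewrite /tsums in sum3; rewrite sum3 nth_default // /k; lia.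
by rewrite size_map size_mask_support; lia.
Qed.

Definition smallb (g : seq nat) := nsums_mask g + 2 <= 3 * size g.

Lemma smallbE g : smallb g = small g.
Proof. by rewrite /small nsumsE. Qed.

(* A conditional rather than ==>, whose second argument call-by-value would always evaluate. *)
Fixpoint all_extensions (P : pred (seq nat)) n g :=
  if n is n'.+1 then
    next_gap_le4 g &&
    all (fun y => if smallb (rcons g y) then all_extensions P n' (rcons g y) else true)
      [:: 1; 2; 3; 4]
  else P g.

(** Cutting the search at a prefix that is not [small] loses nothing, since a prefix with at least
    two gaps of a [small] list is [small]. *)
Lemma all_extensionsP P q g : all_extensions P (size q) g -> 2 <= size g ->
  positive (g ++ q) -> small (g ++ q) -> P (g ++ q).
Proof.
elim: q g => [|y q IHq] g; first by rewrite cats0.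
rewrite [size (y :: q)]/=; case/andP=> le4 /allP y_ext g_ge2 pos small_gq.
rewrite -cat_rcons in pos small_gq *.
have gy_pos : positive (rcons g y) by move: pos; rewrite positive_cat => /andP[].
have small_gy : small (rcons g y).
  by apply: (@small_window [::] _ q) => //; rewrite size_rcons; lia.
have /y_ext := next_gap_le4P le4 gy_pos small_gy.
by rewrite smallbE small_gy => /IHq; apply=> //; rewrite size_rcons; lia.
Qed.

(** * The possible shapes, and the sets of 13 elements *)

(* Gaps at an end of the set, listed inwards, with the excess that they cause. *)
Definition end_patterns : seq (seq nat * nat) :=
  [:: ([::], 0); ([:: 2], 1); ([:: 1; 2], 2); ([:: 1; 1; 2], 2); ([:: 3], 2);
      ([:: 4], 3); ([:: 2; 2], 3); ([:: 2; 1; 2], 3)].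

Definition end_form (g : seq nat) := exists l r t,
  [/\ l \in end_patterns, r \in end_patterns, l.2 + r.2 <= 3
    & g = l.1 ++ nseq t 1 ++ rev r.1].

(** One interior element, [a + 1], is missing. A hole with fewer than three gaps 1 on one side is
    described by the end patterns [[:: 2]], [[:: 1; 2]] and [[:: 1; 1; 2]]. *)
Definition middle_form (g : seq nat) := exists a b,
  [/\ 3 <= a, 3 <= b & g = nseq a 1 ++ 2 :: nseq b 1].

Definition formb (g : seq nat) :=
  has (fun l => has (fun r => (l.2 + r.2 <= 3) &&
    (g == l.1 ++ nseq (size g - size l.1 - size r.1) 1 ++ rev r.1))
      end_patterns) end_patterns
  || has (fun a => g == nseq a 1 ++ 2 :: nseq (size g - a.+1) 1) (iota 3 (size g - 6)).

Lemma formP g : formb g -> end_form g \/ middle_form g.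
Proof.
case/orP=> [/hasP[l l_in /hasP[r r_in /andP[cost /eqP ->]]]|/hasP[a a_in /eqP ->]].
  by left; exists l, r, (size g - size l.1 - size r.1).
by right; exists a, (size g - a.+1); move: a_in; rewrite mem_iota; split=> //; lia.
Qed.

(** Here [i] counts the gaps before the run of four gaps 1, and [8 - i] those after it. The list is
    first grown to the right, then reversed so that the same search grows the left side, and
    reversed back for the test. *)
Definition check13 := all (fun i =>
  all_extensions (fun h => all_extensions (fun u => formb (rev u)) i (rev h))
    (8 - i) (nseq 4 1)) (iota 0 9).

Lemma check13_true : check13.
Proof. by vm_compute. Qed.

Lemma form13 p q : size p + size q = 8 -> positive (p ++ nseq 4 1 ++ q) ->
  small (p ++ nseq 4 1 ++ q) -> formb (p ++ nseq 4 1 ++ q).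
Proof.
move=> sz pos small_g.
have /(allP check13_true) : size p \in iota 0 9 by rewrite mem_iota; lia.
have -> : 8 - size p = size q by lia.
move: (nseq 4 1) (size_nseq 4 1) pos small_g => o sz_o pos small_g /all_extensionsP.
have oq_pos : positive (o ++ q) by move: pos; rewrite positive_cat => /andP[].
have oq_ge2 : 2 <= size (o ++ q) by rewrite size_cat sz_o.
have small_oq : small (o ++ q) by have := @small_window p (o ++ q) [::]; rewrite cats0; apply.
rewrite sz_o oq_pos small_oq => /(_ isT isT isT).
rewrite -(size_rev p) => /all_extensionsP; rewrite -rev_cat revK; apply.
- by rewrite size_rev.
- by rewrite positive_rev.
by move: small_g; rewrite /small nsums_rev // size_rev.
Qed.

(** * Preservation of the shapes when a gap is appended *)

(* The excesses on both sides of a run of gaps 1, with the run cut down to six gaps, add up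
   to at most 3. *)
Definition step_pairs (l r : seq nat) y :=
  nsums_mask (l ++ nseq 6 1) + nsums_mask (nseq 6 1 ++ rcons r y)
    <= 3 * (size l + size r) + 32.

(** Cutting the run down to six gaps removes at least [3 * (t - 6)] sums on each side. The constant
    32 is [3 * 6 - 5], for the sums shared along the run, plus [3 * 7 - 2], the share of the run and
    [y] in the bound of [small]. *)
Lemma step_pairsP l t r y : 6 <= t -> positive (l ++ nseq t 1 ++ rcons r y) ->
  small (l ++ nseq t 1 ++ rcons r y) -> step_pairs l r y.
Proof.
move=> t_ge6 pos; have t_ge2 : 2 <= t by lia.
have := nsums_overlap_run pos t_ge2.
move: (pos); rewrite catA positive_cat => /andP[lt_pos ry_pos].
have tr_pos : positive (nseq t 1 ++ rcons r y) by move: pos; rewrite positive_cat => /andP[].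
have le_l : nsums (l ++ nseq 6 1) + 3 * (t - 6) <= nsums (l ++ nseq t 1).
  have := @nsums_cat_ge (l ++ nseq 6 1) (nseq (t - 6) 1).
  by rewrite -catA -nseqD subnKC // size_nseq; apply=> //; rewrite size_cat size_nseq; lia.
have le_r : nsums (nseq 6 1 ++ rcons r y) + 3 * (t - 6) <= nsums (nseq t 1 ++ rcons r y).
  have := @nsums_window (nseq (t - 6) 1) (nseq 6 1 ++ rcons r y) [::].
  by rewrite cats0 catA -nseqD subnK // size_nseq addn0; apply.
rewrite /small /step_pairs -!nsumsE !size_cat size_nseq size_rcons; lia.
Qed.

(** The gap may lengthen the run or turn the right end pattern into another one. The last
    alternative puts a third gap 1 after the hole of [[:: 1; 1; 2]], which gives the middle form. *)
Definition step_ok (l r : seq nat * nat) y := step_pairs l.1 (rev r.1) y ==>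
  [|| (y == 1) && (r.1 == [::]),
      has (fun r' => (r'.1 == y :: r.1) && (l.2 + r'.2 <= 3)) end_patterns
    | [&& l.1 == [::], y == 1 & r.1 == [:: 1; 1; 2]]].

Definition check_steps := all (fun l => all (fun r => (l.2 + r.2 <= 3) ==>
   next_gap_le4 (nseq 6 1 ++ rev r.1) && all (step_ok l r) [:: 1; 2; 3; 4])
  end_patterns) end_patterns.

Lemma check_steps_true : check_steps.
Proof. by vm_compute. Qed.

Lemma form_step g y : 12 <= size g -> end_form g \/ middle_form g ->
  positive (rcons g y) -> small (rcons g y) ->
  end_form (rcons g y) \/ middle_form (rcons g y).
Proof.
move=> sz [[l [r [t [l_in r_in cost def_g]]]]|[a [b [a_ge3 b_ge3 def_g]]]] pos small_gy.
  have t_ge6 : 6 <= t.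
    have short x : x \in end_patterns -> size x.1 <= 3.
      exact: (@allP _ (fun x => size x.1 <= 3) end_patterns isT).
    move: sz (short l l_in) (short r r_in); rewrite def_g !size_cat size_nseq size_rev.
    by move: (size l.1) (size r.1) => n m; lia.
  have def_gy : rcons g y = l.1 ++ nseq t 1 ++ rcons (rev r.1) y.
    by rewrite def_g -!cats1 -!catA.
  have def_gy6 : rcons g y =
      (l.1 ++ nseq (t - 6) 1) ++ rcons (nseq 6 1 ++ rev r.1) y ++ [::].
    by rewrite def_gy cats0 -cats1 -!catA (catA _ (nseq 6 1)) -nseqD subnK // cats1.
  have /andP[le4 /allP/(_ y) y_ok] := implyP (allP (allP check_steps_true l l_in) r r_in) cost.
  have {le4}y_in : y \in [:: 1; 2; 3; 4].
    apply: next_gap_le4P le4 _ _.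
      by move: pos; rewrite def_gy6 !positive_cat => /and3P[].
    by apply: (small_window (p := l.1 ++ nseq (t - 6) 1) (q := [::])); rewrite -?def_gy6.
  have /implyP := y_ok y_in; rewrite def_gy in pos small_gy.
  move/(_ (step_pairsP t_ge6 pos small_gy)) => {}y_ok; rewrite def_gy.
  case/or3P: y_ok => [/andP[/eqP-> /eqP->]|/hasP[r' r'_in /andP[/eqP def_r' cost']]|].
  - left; exists l, ([::], 0), t.+1; split=> //; first by rewrite addn0; lia.
    by rewrite -[t.+1]addn1 nseqD -!catA.
  - by left; exists l, r', t; rewrite def_r' rev_cons.
  case/and3P=> /eqP-> /eqP-> /eqP->; right; exists t, 3; split=> //; lia.
have [y1|y_neq1] := eqVneq y 1.
  right; exists a, b.+1; split=> //; first by rewrite ltnW.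
  by rewrite def_g y1 -[b.+1]addn1 nseqD -cats1 -catA.
(* A hole with long runs around it uses up the excess 3, so a last gap other than 1 is too much. For
   [b >= 6] the excesses are added across the right run. *)
exfalso; have [b_ge6|b_lt6] := leqP 6 b.
  have def_gy : rcons g y =
      nseq (a - 3) 1 ++ ([:: 1; 1; 1; 2] ++ nseq b 1 ++ rcons [::] y) ++ [::].
    rewrite cats0 def_g -cats1 -catA /= -[X in nseq X](subnK a_ge3) nseqD -catA.
    by [].
  have def_gy6 : rcons g y =
      (nseq a 1 ++ 2 :: nseq (b - 6) 1) ++ rcons (nseq 6 1) y ++ [::].
    by rewrite cats0 def_g -!cats1 -{1}(subnK b_ge6) nseqD -!catA !cat_cons -!catA.
  have y_in : y \in [:: 1; 2; 3; 4].
    apply: (@next_gap_le4P (nseq 6 1)) => //.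
      by move: pos; rewrite def_gy6 !positive_cat => /and3P[_ ->].
    by apply: (small_window (p := nseq a 1 ++ 2 :: nseq (b - 6) 1) (q := [::])); rewrite -?def_gy6.
  have pos' : positive ([:: 1; 1; 1; 2] ++ nseq b 1 ++ rcons [::] y).
    by move: pos; rewrite def_gy !positive_cat => /and3P[].
  have small' : small ([:: 1; 1; 1; 2] ++ nseq b 1 ++ rcons [::] y).
    by apply: (small_window (p := nseq (a - 3) 1) (q := [::])); rewrite -?def_gy.
  have := step_pairsP b_ge6 pos' small'.
  by move: y_in y_neq1; rewrite !inE => /or4P[] /eqP-> // _; vm_compute.
(* Now [b <= 5], so twelve gaps leave [a >= 6]; with the left run cut to six gaps, finitely many
   lists remain to be evaluated. *)
pose w := nseq 6 1 ++ 2 :: nseq b 1.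
have def_gy : rcons g y = nseq (a - 6) 1 ++ rcons w y ++ [::].
  have a_ge6 : 6 <= a by move: sz; rewrite def_g size_cat /= !size_nseq; lia.
  by rewrite cats0 def_g /w -!cats1 -{1}(subnK a_ge6) nseqD -!catA.
have pos_w : positive (rcons w y) by move: pos; rewrite def_gy !positive_cat => /and3P[].
have small_w : small (rcons w y).
  by apply: (small_window (p := nseq (a - 6) 1) (q := [::])); rewrite -?def_gy.
have b_in : b \in [:: 3; 4; 5] by rewrite !inE; lia.
have le4 : next_gap_le4 w.
  by move: b_in; rewrite /w !inE => /or3P[] /eqP->; vm_compute.
have := next_gap_le4P le4 pos_w small_w; rewrite !inE (negPf y_neq1) /= => y_in.
move: small_w b_in; rewrite -smallbE /w !inE.
by case/or3P: y_in => /eqP-> small_w /or3P[] /eqP b_eq; move: small_w; rewrite b_eq; vm_compute.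
Qed.

(** * The shape of every gap list of excess at most 3 *)

Lemma gaps_form g : positive g -> 12 <= size g -> small g ->
    (forall D, all (dvdn D) g -> D = 1) -> end_form g \/ middle_form g.
Proof.
move=> pos sz small_g gcd1.
have sz12 : size (take 12 g) = 12 by rewrite size_takel.
have pos12 : positive (take 12 g).
  by move: pos; rewrite -{1}[g](cat_take_drop 12) positive_cat => /andP[].
have small12 : small (take 12 g).
  by apply: (small_window (p := [::]) (q := drop 12 g)); rewrite /= ?cat_take_drop ?sz12.
have [p [D [q def12]]] := exists_run pos12 sz12 small12.
have def_g : g = p ++ nseq 4 D ++ q ++ drop 12 g.
  by rewrite -{1}[g](cat_take_drop 12) def12 -!catA.
(* This gives divisibility to the right of the run; applied to the reversed list it gives the left
   side, and [D = 1] follows. *)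
have D_right u v : positive (u ++ nseq 4 D ++ v) -> small (u ++ nseq 4 D ++ v) -> all (dvdn D) v.
  move=> uv_pos uv_small; apply: dvd_right_of_run.
    by move: uv_pos; rewrite positive_cat => /andP[].
  have := @small_window u (nseq 4 D ++ v) [::].
  by rewrite cats0 {2}/small [size (_ ++ v)]size_cat; apply.
have Dq : all (dvdn D) (q ++ drop 12 g) by apply: (D_right p); rewrite -def_g.
have Dp : all (dvdn D) (rev p).
  apply: (D_right (rev (q ++ drop 12 g)));
    rewrite -[nseq 4 D]/(rev (nseq 4 D)) -!rev_cat -catA -def_g ?positive_rev //.
  by move: small_g; rewrite /small nsums_rev // size_rev.
have D1 : D = 1 by apply: gcd1; rewrite def_g all_cat -all_rev Dp all_cat Dq /= !dvdnn.
have : end_form (take 12 g) \/ middle_form (take 12 g).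
  apply: formP; rewrite def12 D1; rewrite def12 D1 in sz12 pos12 small12.
  by apply: form13 => //; move: sz12; rewrite !size_cat size_nseq; lia.
move: pos small_g; rewrite -{1 2 5 6}[g](cat_take_drop 12); move: (drop 12 g) => r.
elim/last_ind: r => [|r y IHr]; first by rewrite cats0.
rewrite -rcons_cat => posy smally form12.
have posr : positive (take 12 g ++ r) by move: posy; rewrite /positive all_rcons => /andP[].
apply: form_step => //; first by rewrite size_cat sz12 leq_addr.
apply: IHr => //; apply: (small_window (p := [::]) (q := [:: y])); rewrite ?cats1 //=.
by rewrite size_cat sz12.
Qed.

(** * Excluding excess below 3 *)

Lemma nsums_le_bounds g lo hi : {in tsums g, forall v, lo <= v <= hi} ->
  nsums g <= hi.+1 - lo.
Proof.
move=> bd; rewrite -[hi.+1 - lo](size_iota lo); apply: geq_nsums => v /bd.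
by rewrite mem_iota; lia.
Qed.

Lemma mem_pts_nil x : (x \in pts [::]) = (x == 0).
Proof. by rewrite inE. Qed.

Definition mem_ptsE := (mem_pts_cat, mem_pts_cons, mem_pts_nseq1, mem_pts_nil, sumn_nseq).

(** The end patterns of cost at most 2. *)
Definition cheap_ends : seq (seq nat) := [:: [::]; [:: 2]; [:: 1; 2]; [:: 1; 1; 2]; [:: 3]].

(** Counting the integers from the smallest to the largest sum shows that a single cheap end next to
    a run has excess at most 2. *)
Lemma nsums_left_end l t : l \in cheap_ends -> 2 <= t ->
  nsums (l ++ nseq t 1) + 2 < 3 * size (l ++ nseq t 1).
Proof.
move=> l_in t_ge2; have t1_pos : positive (nseq t 1) by rewrite /positive all_nseq orbT.
have le_bounds u lo hi : positive (u ++ nseq t 1) ->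
    {in pts (u ++ nseq t 1) & &, forall x y z, x < y -> y < z -> lo <= x + y + z <= hi} ->
    nsums (u ++ nseq t 1) <= hi.+1 - lo.
  move=> pos bd; apply: nsums_le_bounds => v /(tsumsP _ pos)[x [y [z [[xg yg zg]]]]].
  by case=> xy yz ->; apply: bd.
move: l_in; rewrite !inE size_cat size_nseq => /or4P[|||/orP[]] /eqP->.
- have := le_bounds [::] 3 (3 * t - 3); rewrite /= => /(_ t1_pos) le.
  apply: (@leq_ltn_trans ((3 * t - 3).+1 - 3 + 2)); last by lia.
  by rewrite leq_add2r; apply: le => x y z; rewrite !mem_ptsE; lia.
- apply: (@leq_ltn_trans ((3 * t + 3).+1 - 5 + 2)); last by rewrite /=; lia.
  by rewrite leq_add2r; apply: le_bounds => // x y z; rewrite !mem_ptsE /=; lia.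
- apply: (@leq_ltn_trans ((3 * t + 6).+1 - 4 + 2)); last by rewrite /=; lia.
  by rewrite leq_add2r; apply: le_bounds => // x y z; rewrite !mem_ptsE /=; lia.
(* The elements start 0, 1, 2, 4, so 4 is not a sum; counting the full interval would be one too
   many for the strict bound. *)
- apply: (@leq_ltn_trans (size (3 :: iota 5 (3 * t + 5)) + 2)); last first.
    by rewrite /= size_iota; lia.
  have mem_le u : u \in pts ([:: 1; 1; 2] ++ nseq t 1) -> (u != 3) && (u <= t + 4).
    by rewrite !mem_ptsE /=; lia.
  rewrite leq_add2r; apply: geq_nsums => v /tsumsP[//|x [y [z [[]]]]].
  by move=> /mem_le xP /mem_le yP /mem_le zP [xy yz ->]; rewrite inE mem_iota; lia.
apply: (@leq_ltn_trans ((3 * t + 6).+1 - 7 + 2)); last by rewrite /=; lia.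
by rewrite leq_add2r; apply: le_bounds => // x y z; rewrite !mem_ptsE /=; lia.
Qed.

Lemma nsums_both_ends t : nsums ([:: 2] ++ nseq t 1 ++ [:: 2]) <= 3 * t + 3.
Proof.
have pos : positive ([:: 2] ++ nseq t 1 ++ [:: 2]) by rewrite !positive_cat /positive all_nseq orbT.
rewrite [leqRHS](_ : _ = (3 * t + 7).+1 - 5); last by lia.
have mem_le u : u \in pts ([:: 2] ++ nseq t 1 ++ [:: 2]) ->
    [&& u != 1, u != t + 3 & u <= t + 4] by rewrite !mem_ptsE /=; lia.
apply: nsums_le_bounds => v /(tsumsP _ pos)[x [y [z [[]]]]].
by move=> /mem_le xP /mem_le yP /mem_le zP [xy yz ->]; lia.
Qed.

(** With total cost at most 2, either one end is empty and the other cheap, or both ends are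
    [[:: 2]]. In each case the excess is at most 2, against the assumed 3. *)
Lemma end_form_cost l r t : l \in end_patterns -> r \in end_patterns -> l.2 + r.2 <= 3 ->
  2 <= t -> 3 * size (l.1 ++ nseq t 1 ++ rev r.1) <= nsums (l.1 ++ nseq t 1 ++ rev r.1) + 2 ->
  l.2 + r.2 = 3.
Proof.
have right_end u : u \in cheap_ends -> 2 <= t ->
    nsums (nseq t 1 ++ rev u) + 2 < 3 * size (nseq t 1 ++ rev u).
  move=> u_in t_ge2; have rev_ut : nseq t 1 ++ rev u = rev (u ++ nseq t 1).
    by rewrite rev_cat rev_nseq.
  rewrite rev_ut size_rev nsums_rev; first exact: nsums_left_end.
  rewrite positive_cat /positive all_nseq orbT andbT.
  by move: u u_in {rev_ut}; apply/allP.
move=> l_in r_in cost t_ge2 le_g; apply/eqP; rewrite eqn_leq cost leqNgt; apply/negP => cost2.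
have cases : all (fun l => all (fun r => (l.2 + r.2 < 3) ==>
    [|| (r.1 == [::]) && (l.1 \in cheap_ends), (l.1 == [::]) && (r.1 \in cheap_ends)
      | (l.1 == [:: 2]) && (r.1 == [:: 2])]) end_patterns) end_patterns by [].
have := implyP (allP (allP cases l l_in) r r_in) cost2.
case/or3P=> /andP[/eqP eq1]; last move/eqP=> eq2; move: le_g; rewrite ?eq1 ?eq2 ?cats0 leqNgt.
- by move=> + /nsums_left_end => /negP le_g /(_ t t_ge2).
- by move=> + /right_end => /negP le_g /(_ t_ge2).
have := nsums_both_ends t; rewrite -[rev [:: 2]]/[:: 2] !size_cat size_nseq [size _]/=.
by move=> le /negP[]; apply: (@leq_ltn_trans (3 * t + 3 + 2)); [rewrite leq_add2r | lia].
Qed.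

Local Open Scope fset_scope.
Local Open Scope ring_scope.

(** * Translation from finite sets of integers to gap lists *)

Lemma exists_gaps (a : nat) (s : seq nat) : path ltn a s ->
  exists2 g, positive g & a :: s = [seq (a + x)%N | x <- pts g].
Proof.
elim: s a => [|b s IHs] a /=; first by exists [::] => //=; rewrite addn0.
case/andP=> ab /IHs[g g_pos def_s]; exists (b - a :: g)%N.
  by rewrite /= subn_gt0 ab.
rewrite def_s -[pts (_ :: g)]/(0 :: [seq (b - a + x)%N | x <- pts g]) /= addn0 -map_comp.
by congr cons; apply: eq_map => x /=; lia.
Qed.

Lemma mem_gaps (A : {fset int}) : is_min A 0 -> exists2 g, positive g &
  forall x : int, (x \in A) = (0 <= x) && (absz x \in pts g).
Proof.
case=> A0 A_ge0; pose s := sort leq [seq absz x | x <- A].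
have absK : {in A, forall x, (absz x)%:Z = x} by move=> x /A_ge0 ?; rewrite gez0_abs.
have s_sorted : sorted ltn s.
  rewrite ltn_sorted_uniq_leq sort_uniq sort_sorted ?andbT; last exact: leq_total.
  by rewrite map_inj_in_uniq ?fset_uniq // => x y /absK {2}<- /absK {2}<- ->.
have mem_s x : (x \in A) = (0 <= x) && (absz x \in s).
  rewrite mem_sort; apply/idP/andP => [xA|[x_ge0 /mapP[y yA]]].
    by rewrite A_ge0 // map_f.
  by move=> eq_xy; rewrite -(gez0_abs x_ge0) eq_xy absK.
have s0 : 0%N \in s by move: (mem_s 0); rewrite A0 => /esym/andP[].
case def_s: s s0 s_sorted => [//|a s'] s0 s_sorted.
have a0 : a = 0%N.
  move: s0; rewrite inE => /predU1P[//|].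
  by move: s_sorted => /=; rewrite (path_sortedE ltn_trans) => /andP[/allP a_min _] /a_min.
have [g g_pos] := exists_gaps s_sorted; rewrite a0 map_id_in // => def_pts.
by exists g => // x; rewrite mem_s def_s a0 def_pts.
Qed.

Lemma card_restricted_sumset3 (A : {fset int}) g : positive g ->
    (forall x : int, (x \in A) = (0 <= x) && (absz x \in pts g)) ->
  #|` restricted_sumset 3 A| = nsums g.
Proof.
move=> g_pos memA.
have memAz n : (n%:Z \in A) = (n \in pts g) by rewrite memA.
rewrite /nsums -(size_map Posz); apply: perm_size; apply: uniq_perm.
- exact: fset_uniq.
- by rewrite map_inj_uniq ?undup_uniq // => x y [].
move=> v; apply/restricted_sumsetP/mapP => [[B [BA B3 ->]]|[w]].
  have [x [y [z [B_perm xy yz]]]] : exists x y z : int,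
      [/\ perm_eq B [:: x; y; z], x < y & y < z].
    have := sort_lt_sorted B; rewrite fset_uniq.
    have : perm_eq (sort <=%R B) B by apply/permPl/perm_sort.
    case: (sort _ _) => [|x [|y [|z [|? ?]]]] B_perm; have := perm_size B_perm; rewrite B3 //= => _.
    by case/and3P=> xy yz _; exists x, y, z; rewrite perm_sym.
  have inA u : u \in [:: x; y; z] -> u \in A.
    by rewrite -(perm_mem B_perm); apply: (fsubsetP BA).
  have := inA x; have := inA y; have := inA z; rewrite !inE !eqxx ?orbT !memA.
  move=> /(_ isT)/andP[z0 zg] /(_ isT)/andP[y0 yg] /(_ isT)/andP[x0 xg].
  exists (absz x + absz y + absz z)%N.
    rewrite mem_undup; apply/tsumsP => //; exists (absz x), (absz y), (absz z).
    by split=> //; split=> //; lia.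
  by rewrite (perm_big _ B_perm) /= !big_cons big_nil; lia.
rewrite mem_undup => /(tsumsP _ g_pos)[x [y [z [[xg yg zg] [xy yz ->]]]]] ->.
exists [fset x%:Z; y%:Z; z%:Z].
have B_perm : perm_eq [fset x%:Z; y%:Z; z%:Z] [:: x%:Z; y%:Z; z%:Z].
  apply: uniq_perm; rewrite ?fset_uniq //=; first by rewrite !inE; lia.
  by move=> u; rewrite !inE orbA.
split.
- by apply/fsubsetP => u; rewrite !inE => /orP[/orP[]|] /eqP->; rewrite memAz.
- exact: perm_size B_perm.
by rewrite (perm_big _ B_perm) /= !big_cons big_nil; lia.
Qed.

Lemma size_gaps (A : {fset int}) g : positive g ->
    (forall x : int, (x \in A) = (0 <= x) && (absz x \in pts g)) ->
  #|` A| = (size g).+1.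
Proof.
move=> g_pos memA; rewrite -size_pts -(size_map Posz); apply: perm_size.
apply: uniq_perm; first exact: fset_uniq.
  by rewrite map_inj_uniq ?(sorted_uniq ltn_trans ltnn) ?sorted_pts // => x y [].
move=> x; rewrite memA; apply/andP/mapP => [[x0 xg]|[n ng ->]] //.
by exists (absz x); rewrite // gez0_abs.
Qed.

Lemma gaps_coprime (A : {fset int}) g D :
    (forall x : int, (x \in A) = (0 <= x) && (absz x \in pts g)) ->
  gcd_fset A = 1 -> all (dvdn D) g -> D = 1%N.
Proof.
move=> memA gcd1 D_g.
have : (D %| gcd_fset A)%Z.
  rewrite /gcd_fset big_seq; elim/big_ind: _ => [|x y Dx Dy|x].
  - exact: dvdz0.
  - by rewrite dvdz_gcd Dx.
  - by rewrite memA dvdzE => /andP[_ /(dvd_pts D_g)].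
by rewrite gcd1 dvdzE dvdn1 => /eqP.
Qed.

Theorem theorem1p13 (k : nat) (A : {fset int})
  (hk : (13 <= k)%N)
  (hA : #|` A| = k)
  (hmin : is_min A 0)
  (hgcd : gcd_fset A = 1)
  (h3 : #|` restricted_sumset 3 A| = (3 * k - 5)%N) :
  let K : int := k%:Z in
  exists x y z : int,
    A = int_interval 0 (K + 2) `\` [fset x; y; z] /\
    ([fset x; y; z] = [fset 1; 2; 3] \/
     [fset x; y; z] = [fset K - 1; K; K + 1] \/
     [fset x; y; z] = [fset 1; 2; K + 1] \/
     [fset x; y; z] = [fset 1; K; K + 1] \/
     [fset x; y; z] = [fset 1; 3; K + 2] \/
     [fset x; y; z] = [fset K - 2; K; K + 2] \/
     [fset x; y; z] = [fset 1; 4; K + 2] \/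
     [fset x; y; z] = [fset K - 3; K; K + 2] \/
     [fset x; y; z] = [fset 2; K; K + 2] \/
     [fset x; y; z] = [fset 1; K - 1; K + 2] \/
     [fset x; y; z] = [fset 1; K - 2; K + 2] \/
     [fset x; y; z] = [fset 3; K; K + 2] \/
     exists2 r : int, 4 <= r <= K - 4 &
       [fset x; y; z] = [fset r; K + 1; K + 2]).
Proof.
move=> K; have [g g_pos memA] := mem_gaps hmin.
have sz : (size g).+1 = k by rewrite -(size_gaps g_pos memA).
have card3 : nsums g = (3 * k - 5)%N by rewrite -(card_restricted_sumset3 g_pos memA).
have eqA (x y z : int) :
    (forall n : nat, (n \in pts g) = [&& (n <= k + 2)%N, n%:Z != x, n%:Z != y & n%:Z != z]) ->
    A = int_interval 0 (K + 2) `\` [fset x; y; z].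
  move=> mem_g; apply/fsetP => u; rewrite memA in_fsetD in_int_interval !inE mem_g /K; lia.
have sz12 : (12 <= size g)%N by lia.
have small_g : small g by rewrite /small card3; lia.
have := gaps_form g_pos sz12 small_g (fun D => @gaps_coprime A g D memA hgcd).
case=> [[l [r [t [l_in r_in cost def_g]]]]|[a [b [a_ge3 b_ge3 def_g]]]]; last first.
  (* In the middle form the largest element is [k], so [K + 1] and [K + 2] are absent besides the
     hole. *)
  exists (a%:Z + 1), (K + 1), (K + 2); split.
    apply: eqA => n; rewrite def_g !mem_ptsE; move: sz; rewrite def_g size_cat /= !size_nseq.
    by rewrite /K; lia.
  do 12!right; exists (a%:Z + 1) => //; move: sz; rewrite def_g size_cat /= !size_nseq /K; lia.
have t_ge6 : (6 <= t)%N.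
  have short x : x \in end_patterns -> (size x.1 <= 3)%N.
    exact: (@allP _ (fun x => size x.1 <= 3)%N end_patterns isT).
  move: sz12 (short l l_in) (short r r_in); rewrite def_g !size_cat size_nseq size_rev.
  by move: (size l.1) (size r.1) => n m; lia.
have {cost} : (l.2 + r.2 = 3)%N.
  have t_ge2 : (2 <= t)%N by lia.
  have le_g : (3 * size g <= nsums g + 2)%N by rewrite card3; lia.
  by apply: end_form_cost l_in r_in cost t_ge2 _; rewrite -def_g.
have cover x y z :
    (forall n : nat, (n \in pts (l.1 ++ nseq t 1%N ++ rev r.1)) =
       [&& (n <= k + 2)%N, n%:Z != x, n%:Z != y & n%:Z != z]) ->
    A = int_interval 0 (K + 2) `\` [fset x; y; z] by rewrite -def_g; apply: eqA.
rewrite def_g !size_cat size_nseq size_rev in sz.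
move: l_in r_in cover sz; rewrite !inE {def_g eqA sz12 small_g card3 memA}.
(* Of the 64 pairs of end patterns, twelve have total cost 3; each gives one of the first twelve
   triples. *)
do 2![case/or4P=> [|||/or4P[|||/orP[]]] /eqP->] => // cover sz _.
all: rewrite /= in sz; rewrite /fst [rev _]/= in cover.
- exists (K - 1), K, (K + 1); split; last by right; left.
  by apply: cover => n; rewrite !mem_ptsE /= /K; lia.
- exists (K - 2), K, (K + 2); split; last by do 5!right; left.
  by apply: cover => n; rewrite !mem_ptsE /= /K; lia.
- exists (K - 3), K, (K + 2); split; last by do 7!right; left.
  by apply: cover => n; rewrite !mem_ptsE /= /K; lia.
- exists 1, (K - 1), (K + 2); split; last by do 9!right; left.
  by apply: cover => n; rewrite !mem_ptsE /= /K; lia.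
- exists 1, (K - 2), (K + 2); split; last by do 10!right; left.
  by apply: cover => n; rewrite !mem_ptsE /= /K; lia.
- exists 1, K, (K + 1); split; last by do 3!right; left.
  by apply: cover => n; rewrite !mem_ptsE /= /K; lia.
- exists 2, K, (K + 2); split; last by do 8!right; left.
  by apply: cover => n; rewrite !mem_ptsE /= /K; lia.
- exists 3, K, (K + 2); split; last by do 11!right; left.
  by apply: cover => n; rewrite !mem_ptsE /= /K; lia.
- exists 1, 2, (K + 1); split; last by do 2!right; left.
  by apply: cover => n; rewrite !mem_ptsE /= /K; lia.
- exists 1, 2, 3; split; last by left.
  by apply: cover => n; rewrite !mem_ptsE /= /K; lia.
- exists 1, 3, (K + 2); split; last by do 4!right; left.
  by apply: cover => n; rewrite !mem_ptsE /= /K; lia.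
- exists 1, 4, (K + 2); split; last by do 6!right; left.
  by apply: cover => n; rewrite !mem_ptsE /= /K; lia.
Qed.
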